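(* For all positive integers $k$ and $n$, $$\Phi_k(n)\le\left(\frac{e\,\pi^2\,\lfloor (k+1)/2\rfloor\,k!}{2^{k+2}}\right)^{1/k} n^{1/k}+\frac{e-1}{e}\,k.$$
   Context: A finite set $\mathcal A$ of non-negative integers is a $B_k$-sequence if all sums $a_1+\dots+a_k$ of $k$ elements of $\mathcal A$ (repetitions allowed) are different, i.e. distinct multisets $\{a_1,\dots,a_k\}$ of elements of $\mathcal A$ have distinct sums. $\Phi_k(n)$ is the maximum size of a $B_k$-sequence contained in $[0,n]$. *)

(* Defs.v *)
From HB Require Import structures.
From mathcomp Require Import all_boot all_order all_algebra.
From mathcomp Require Import all_classical all_reals all_analysis.
Set Implicit Arguments. Unset Strict Implicit. Unset Printing Implicit Defensive.
Import Order.TTheory GRing.Theory Num.Theory.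

(* A (finite) set A of non-negative integers, given as a sequence, is a
   B_k-sequence if any two k-element multisets of elements of A with the same
   sum are equal.  Multisets of size k are represented by sequences of length
   k up to permutation. *)
Definition is_Bk (k : nat) (A : seq nat) : Prop :=
  forall s t : seq nat, size s = k -> size t = k ->
    all (fun x => x \in A) s -> all (fun x => x \in A) t ->
    sumn s = sumn t -> perm_eq s t.

Definition Phi (k n : nat) : nat :=
  \max_(A : {set 'I_n.+1} | `[< is_Bk k [seq nat_of_ord i | i <- enum A] >]) #|A|.

(* Main.v *)
Require Import Defs.
From HB Require Import structures.
From mathcomp Require Import all_boot all_order all_algebra.
From mathcomp Require Import zify ring lra.
From mathcomp Require Import all_classical all_reals all_analysis.
Import Order.TTheory GRing.Theory Num.Theory.
Local Open Scope ring_scope.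
Import numFieldNormedType.Exports.
Set Implicit Arguments.
Unset Strict Implicit.
Unset Printing Implicit Defensive.

(* Let [q = uphalf k] and let [A] be a [B_k]-sequence with [m >= k] elements.
   Choose a [k]-subset [S] of [A] and give the sign [+] to [q] of its elements
   and [-] to the others.  The [B_k] property makes the
   [M = 'C(m, k) * 'C(k, q)] signed sums distinct integers, so their second
   moment about any point is at least about [M ^ 3 / 12].  Measured from the
   midpoint [n / 2], the elements have absolute value at most [n / 2], and for
   balanced signs the mean square of the signed sums is at most about
   [k n ^ 2 / 4].  Hence [M ^ 2 <= 9 q n ^ 2], and the central binomial estimate
   gives [2 ^ k 'C(m, k) <= 6 q n], where [6 <= e pi ^ 2 / 4].
   Finally [m (m - 1) ... (m - k + 1) >= (m - (1 - 1 / e) k) ^ k].  If [m < k],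
   then [A] is a [B_m]-sequence and the same estimate yields [2 ^ m <= 6 q n]. *)

(** * Spread of distinct integers *)

Lemma sorted_int_nth_gap (s : seq int) (i j : nat) :
  sorted <%R s -> (i <= j < size s)%N -> j%:Z - i%:Z <= s`_j - s`_i.
Proof.
move=> ss; elim: j => [|j IHj] /andP[].
  by rewrite leqn0 => /eqP-> _; rewrite !subrr.
rewrite leq_eqVlt => /orP[/eqP->|]; first by rewrite !subrr.
rewrite ltnS => ij js.
have {IHj} := IHj; rewrite ij (ltnW js) => /(_ isT).
have : s`_j < s`_j.+1 by apply: (sortedP _ ss).
lia.
Qed.

Lemma sum_sqr_centered (M : nat) :
  3 * \sum_(i < M) (M%:Z - 1 - 2 * i%:Z) ^+ 2 = M%:Z * (M%:Z ^+ 2 - 1).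
Proof.
(* The induction needs a centre [c] that does not vary with [M]. *)
have aux (c : int) : 3 * \sum_(i < M) (c - 2 * i%:Z) ^+ 2 =
    M%:Z * (3 * c ^+ 2 - 6 * c * (M%:Z - 1) + 2 * (M%:Z - 1) * (2 * M%:Z - 1)).
  elim: M => [|M IH]; first by rewrite big_ord0; ring.
  by rewrite big_ord_recr /= mulrDr IH -[in RHS]addn1 PoszD; ring.
by rewrite aux; ring.
Qed.

(* Pair the [i]-th smallest element with the [i]-th largest one. *)
Lemma sum_sqr_sorted_int_ge (s : seq int) (c : int) : sorted <%R s ->
  (size s)%:Z * ((size s)%:Z ^+ 2 - 1) <= 3 * \sum_(z <- s) (2 * z - c) ^+ 2.
Proof.
move=> ss; set M := size s.
rewrite (big_nth 0) big_mkord -/M -sum_sqr_centered ler_pM2l //.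
rewrite -(@ler_pM2l _ 2) // mulr_sumr.
rewrite [leRHS](_ : _ = \sum_(i < M) ((2 * s`_i - c) ^+ 2 +
    (2 * s`_(rev_ord i) - c) ^+ 2)); last first.
  rewrite big_split /=.
  rewrite -(@reindex_inj _ _ _ _ (@rev_ord M) xpredT
    (fun i : 'I_M => (2 * s`_i - c) ^+ 2) rev_ord_inj).
  by rewrite mulr_natl mulr2n.
apply: ler_sum => i _; have iM := ltn_ord i.
have : (M%:Z - 1 - 2 * i%:Z) ^+ 2 <= (s`_(rev_ord i) - s`_i) ^+ 2.
  rewrite -[leRHS]real_normK ?num_real // -[leLHS]real_normK ?num_real //.
  rewrite lerXn2r ?nnegrE //.
  case: (leqP i (rev_ord i)) => /= h.
    have := @sorted_int_nth_gap s i (M - i.+1) ss; rewrite h /= -/M.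
    have -> : (M - i.+1 < M)%N by lia.
    move=> /(_ isT); lia.
  have := @sorted_int_nth_gap s (M - i.+1) i ss; rewrite (ltnW h) /= -/M iM.
  move=> /(_ isT); lia.
move: (s`_i) (s`_(rev_ord i)) => x y /= h.
(* Parallelogram identity: [c] enters only through a square, which is dropped. *)
have -> : (2 * x - c) ^+ 2 + (2 * y - c) ^+ 2 =
    2 * (y - x) ^+ 2 + 2 * (x + y - c) ^+ 2 by ring.
by rewrite -[leLHS]addr0 lerD ?ler_pM2l // mulr_ge0 // sqr_ge0.
Qed.

Lemma sum_sqr_int_ge (T : finType) (X : {set T}) (f : T -> int) (c : int) :
  {in X &, injective f} ->
  (#|X|)%:Z * ((#|X|)%:Z ^+ 2 - 1) <= 3 * \sum_(x in X) (2 * f x - c) ^+ 2.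
Proof.
move=> finj; pose s := [seq f x | x <- enum X].
have us : uniq s.
  by rewrite map_inj_in_uniq ?enum_uniq // => x y; rewrite !mem_enum; apply: finj.
have := @sum_sqr_sorted_int_ge (sort <=%R s) c.
rewrite sort_lt_sorted us size_sort size_map -cardE => /(_ isT).
by rewrite (perm_big s) ?perm_sort //= big_map big_enum.
Qed.

(** The doubled values are at least 2 apart in an interval of length [2 * l]. This serves [k <= 2],
    where the averaged second moment has too large a constant. *)
Lemma card_int_span (T : finType) (X : {set T}) (f : T -> int) (c : int) (l : nat) :
  {in X &, injective f} -> {in X, forall x, `|2 * f x - c| <= l%:Z} ->
  (#|X| <= l.+1)%N.
Proof.
move=> finj fl; pose s := [seq f x | x <- enum X].
have us : uniq s.
  by rewrite map_inj_in_uniq ?enum_uniq // => x y; rewrite !mem_enum; apply: finj.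
have := @sorted_int_nth_gap (sort <=%R s) 0 #|X|.-1.
rewrite sort_lt_sorted us size_sort size_map -cardE.
have [-> //|X0] := posnP #|X|.
have bnd i : (i < #|X|)%N -> `|2 * (sort <=%R s)`_i - c| <= l%:Z.
  move=> iX; have : (sort <=%R s)`_i \in sort <=%R s.
    by apply: mem_nth; rewrite size_sort size_map -cardE.
  by rewrite mem_sort => /mapP[x]; rewrite mem_enum => xX ->; apply: fl.
have := bnd 0%N X0; have := bnd #|X|.-1; rewrite (ltn_predL _) X0 => /(_ isT).
move: (sort _ _)`_0 (sort _ _)`__ => x y; rewrite andbT => hy hx /(_ isT isT); lia.
Qed.

(** * Averaging squared signed sums over the choice of signs *)

(** Deleting [i] from [P] is a bijection onto the [p]-subsets of [S :\ i :\ j], so the count is the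
    same for every pair. *)
Lemma card_draws_separating (T : finType) (S : {set T}) (p : nat) (i j : T) :
  i \in S -> j \in S -> i != j ->
  #|[set P : {set T} | [&& P \subset S, #|P| == p.+1, i \in P & j \notin P]]|
    = 'C(#|S|.-2, p).
Proof.
move=> iS jS ij.
have -> : #|S|.-2 = #|S :\ i :\ j|.
  have := cardsD1 i S; have := cardsD1 j (S :\ i).
  by rewrite iS !inE eq_sym ij jS /=; lia.
rewrite -cards_draws.
have nS (Q : {set T}) : Q \subset S :\ i :\ j -> (i \notin Q) /\ (j \notin Q).
  by move=> /fintype.subsetP sQ; split; apply/negP => /sQ; rewrite !inE eqxx ?andbF.
rewrite -[RHS](@card_in_imset _ _ (fun P : {set T} => i |: P)); last first.
  move=> P Q; rewrite !inE => /andP[/nS[iP _] _] /andP[/nS[iQ _] _] eq.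
  by rewrite -(finset.setU1K iP) eq finset.setU1K.
apply: eq_card => P; rewrite inE; apply/and4P/imsetP => [[PS cP iP jP]|[Q]].
  exists (P :\ i); last by rewrite finset.setD1K.
  rewrite inE; apply/andP; split; last first.
    by have := cardsD1 i P; rewrite iP (eqP cP) add1n => -[->].
  by rewrite finset.subsetD1 finset.setSD // !inE (negbTE jP) andbF.
rewrite inE => /andP[sQ /eqP cQ ->].
have [iQ jQ] := nS _ sQ.
split.
- apply/fintype.subsetP => x; rewrite !inE => /predU1P[->//|/(fintype.subsetP sQ)].
  by rewrite !inE => /and3P[].
- by rewrite cardsU1 iQ cQ.
- by rewrite !inE eqxx.
- by rewrite !inE negb_or eq_sym ij.
Qed.

Definition signed_sum (T : finType) (b : T -> int) (S P : {set T}) : int :=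
  \sum_(i in P) b i - \sum_(i in S :\: P) b i.

(* Uses [(\sum_S b)^2 - (signed sum)^2 = 4 (\sum_P b) (\sum_(S \ P) b)]:
   on average over [P] all pairs [i != j] are separated equally often. *)
Lemma second_moment_signed_sum (T : finType) (b : T -> int) (S : {set T}) (p : nat) :
  ('C(#|S|, p.+1) <= 4 * 'C(#|S|.-2, p))%N ->
  \sum_(P : {set T} | (P \subset S) && (#|P| == p.+1)) signed_sum b S P ^+ 2
    <= (4 * 'C(#|S|.-2, p))%:Z * \sum_(i in S) b i ^+ 2.
Proof.
move=> hC; set D := 'C(#|S|.-2, p) in hC *.
set Y := \sum_(P | _) _.
pose s := \sum_(i in S) b i.
pose Q (P : {set T}) := (P \subset S) && (#|P| == p.+1).
have cross : \sum_(P | Q P) (\sum_(i in P) b i) * (\sum_(j in S :\: P) b j) =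
    D%:Z * (s ^+ 2 - \sum_(i in S) b i ^+ 2).
  transitivity (\sum_(P | Q P) \sum_(i in S) \sum_(j in S)
      (b i * b j) *+ ((i \in P) && (j \notin P))).
    apply: eq_bigr => P /andP[/fintype.subsetP PS _]; rewrite big_distrlr /=.
    rewrite big_mkcond [RHS]big_mkcond; apply: eq_bigr => i _ /=.
    have [iP|iP] := boolP (i \in P); last by rewrite big1 ?if_same.
    rewrite (PS _ iP) big_mkcond [RHS]big_mkcond; apply: eq_bigr => j _ /=.
    by rewrite inE; case: (j \in P); case: (j \in S).
  transitivity (\sum_(i in S) \sum_(j in S) (D%:Z * (b i * b j)) *+ (i != j)).
    rewrite exchange_big; apply: eq_bigr => i iS.
    rewrite exchange_big; apply: eq_bigr => j jS /=.
    have [->|ij] := eqVneq i j.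
      by rewrite big1 // => P _; rewrite andbN.
    rewrite mulr1n sumrMnr -mulr_natl natz; congr (Posz _ * _).
    rewrite /D -(card_draws_separating p iS jS ij) -sum1_card big_mkcond /=.
    rewrite [RHS]big_mkcond /=; apply: eq_bigr => P _; rewrite inE /Q.
    by case: (P \subset S); case: (_ == _); case: (i \in P); case: (j \in P).
  rewrite expr2 big_distrlr -sumrB mulr_sumr; apply: eq_bigr => i iS.
  rewrite (bigD1 i) //= [in RHS](bigD1 i) //= eqxx mulr0n add0r expr2.
  rewrite addrAC subrr add0r mulr_sumr; apply: eq_bigr => j /andP[_ ji].
  by rewrite eq_sym ji.
have -> : Y = 'C(#|S|, p.+1)%:Z * s ^+ 2 - 4 * (D%:Z * (s ^+ 2 - \sum_(i in S) b i ^+ 2)).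
  rewrite -cross mulr_sumr.
  have -> : 'C(#|S|, p.+1)%:Z * s ^+ 2 = \sum_(P | Q P) s ^+ 2.
    rewrite -cards_draws -natz mulr_natl -sumr_const.
    by apply: eq_bigl => P; rewrite inE.
  rewrite -sumrB; apply: eq_bigr => P /andP[PS _].
  rewrite /signed_sum /s (@big_setID _ _ _ _ S P) (finset.setIidPr PS) /=; ring.
(* The coefficient of [s ^+ 2] is ['C(#|S|, p.+1) - 4 * D], which is nonpositive by [hC]. *)
have : 0 <= s ^+ 2 by exact: sqr_ge0.
rewrite PoszM; nia.
Qed.

(** * Middle binomial coefficients *)

(** The ratio of consecutive central coefficients is [2 * m.*2.+1 / m.+1], so the induction step
    reduces to [4 * m * m.+1 <= m.*2.+1 ^ 2]. *)
Lemma central_bin_ge (q : nat) : (0 < q)%N ->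
  (16 ^ q <= 4 * q * 'C(q.*2, q) ^ 2)%N.
Proof.
elim: q => // -[_ _|q IH _]; first by [].
have := IH isT; set m := q.+1; rewrite expnS doubleS.
have := mul_bin_diag m.*2.+2 m; have := mul_bin_down m.*2.+1 m.
rewrite /= => e1 e2 h.
set x := 'C(m.*2, m) in e1 h; set y := 'C(m.*2.+1, m) in e1 e2.
set z := 'C(m.*2.+2, m.+1) in e2 *.
have {}e1 : (m.*2.+1 * x = m.+1 * y)%N by rewrite e1; congr muln; lia.
have {e2} -> : z = (2 * y)%N.
  by apply/eqP; rewrite -(@eqn_pmul2l m.+1) // -e2; apply/eqP; lia.
rewrite -(@leq_pmul2l m.+1) //.
have -> : (m.+1 * (4 * m.+1 * (2 * y) ^ 2) = 16 * (m.*2.+1 * x) ^ 2)%N.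
  rewrite e1; ring.
apply: (@leq_trans (m.+1 * (16 * (4 * m * x ^ 2)))).
  by rewrite !leq_mul2l h !orbT.
have -> : (m.+1 * (16 * (4 * m * x ^ 2)) = 16 * (4 * m * m.+1 * x ^ 2))%N by ring.
rewrite expnMn leq_mul2l leq_mul2r; apply/orP; right; apply/orP; right.
rewrite -muln2; nia.
Qed.

(** Even [k] is the central case; for odd [k] the central coefficient of row [k.+1] is twice the
    middle one of row [k]. *)
Lemma half_bin_ge (k : nat) : (0 < k)%N ->
  ((2 ^ k) ^ 2 <= 4 * uphalf k * 'C(k, uphalf k) ^ 2)%N.
Proof.
move=> k0; have kE := odd_double_half k; rewrite uphalf_half.
have pow4 i : ((2 ^ i) ^ 2 = 4 ^ i)%N by rewrite -expnM mulnC expnM.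
have pow16 i : (16 ^ i = 4 ^ i.*2)%N by rewrite -mul2n expnM.
case: (odd k) kE => /=; set q := k./2; rewrite ?add1n ?add0n => kE; last first.
  by rewrite pow4 -kE -pow16 central_bin_ge // half_gt0; lia.
have := @central_bin_ge q.+1 isT; have := mul_bin_down q.+1.*2 q.+1.
rewrite doubleS /= kE pow16 doubleS kE pow4 => e.
set x := 'C(k, q.+1) in e *; set y := 'C(k.+1, q.+1) in e *.
have -> : y = (2 * x)%N.
  by apply/eqP; rewrite -(@eqn_pmul2l q.+1) //; apply/eqP; lia.
by rewrite expnS; lia.
Qed.

(** With [q = uphalf k], two absorptions give the factor [k * (k - 1) / (k - q)], which is
    [4 * q - 2] both for [k = 2 * q] and for [k = 2 * q - 1]. *)
Lemma half_bin_sub2 (k : nat) : (1 < k)%N ->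
  (uphalf k * 'C(k, uphalf k) = (4 * uphalf k - 2) * 'C(k.-2, (uphalf k).-1))%N.
Proof.
move=> k1; set q := uphalf k.
have q0 : (0 < q)%N by rewrite /q; lia.
have := mul_bin_diag k q.-1; have := mul_bin_down k.-1 q.-1.
rewrite prednK // => e1 e2; have : (k - q > 0)%N by rewrite /q; lia.
set x := 'C(k.-2, _) in e1 *; set y := 'C(k.-1, _) in e1 e2.
set z := 'C(k, _) in e2 *; move=> kq.
apply/eqP; rewrite -(eqn_pmul2l kq) -e2.
have {}e1 : (k.-1 * x = (k - q) * y)%N by rewrite e1; congr muln; lia.
rewrite mulnCA -e1 !mulnA eqn_mul2r; apply/orP; right; apply/eqP.
have kE := odd_double_half k; move: (kE); rewrite /q uphalf_half.
by case: (odd k) => /= <-; rewrite ?add1n ?add0n -muln2; nia.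
Qed.

(** * Signed sums of a [B_k]-sequence: injectivity and recentring *)

Definition signed_pairs (n k p : nat) (A : {set 'I_n.+1}) :
    {set {set 'I_n.+1} * {set 'I_n.+1}} :=
  [set u : {set 'I_n.+1} * {set 'I_n.+1} |
    [&& u.1 \subset A, #|u.1| == k, u.2 \subset u.1 & #|u.2| == p]].

Lemma big_signed_pairs (n k p : nat) (A : {set 'I_n.+1}) (R : nmodType)
    (F : {set 'I_n.+1} -> {set 'I_n.+1} -> R) :
  \sum_(u in signed_pairs k p A) F u.1 u.2 =
  \sum_(S : {set 'I_n.+1} | (S \subset A) && (#|S| == k))
    \sum_(P : {set 'I_n.+1} | (P \subset S) && (#|P| == p)) F S P.
Proof.
by rewrite pair_big_dep; apply: eq_bigl => -[S P]; rewrite inE /= andbA.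
Qed.

Lemma card_signed_pairs (n k p : nat) (A : {set 'I_n.+1}) :
  #|signed_pairs k p A| = ('C(#|A|, k) * 'C(k, p))%N.
Proof.
rewrite -sum1_card (@big_signed_pairs _ _ _ _ _ (fun _ _ => 1%N)) -cards_draws.
rewrite -sum_nat_const; apply: eq_big => [S|S /andP[_ /eqP <-]]; first by rewrite inE.
by rewrite -cards_draws -sum1_card; apply: eq_bigl => P; rewrite inE.
Qed.

(** Moving the negative parts across turns equal signed sums into equal sums over [P] with
    [S' :\: P'] and over [P'] with [S :\: P], each of [k] terms. In the resulting equality of
    multisets an element of [P] outside [P'] would occur only on the left; hence [P = P'], and then
    [S = S']. *)
Lemma signed_sum_inj (n k p : nat) (A : {set 'I_n.+1}) : (p <= k)%N ->
  is_Bk k [seq nat_of_ord i | i <- enum A] ->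
  {in signed_pairs k p A &, injective
     (fun u => signed_sum (fun i : 'I_n.+1 => (i : nat)%:Z) u.1 u.2)}.
Proof.
move=> pk BkA [S P] [S' P']; rewrite !inE /=.
move=> /and4P[SA /eqP cS PS /eqP cP] /and4P[SA' /eqP cS' PS' /eqP cP'].
rewrite /signed_sum => eqd.
pose l := enum P ++ enum (S' :\: P'); pose l' := enum P' ++ enum (S :\: P).
have card_l (U V W : {set 'I_n.+1}) : V \subset U -> #|U| = k -> #|V| = p -> #|W| = p ->
    size ([seq nat_of_ord i | i <- enum W ++ enum (U :\: V)]) = k.
  by move=> VU cU cV cW; rewrite size_map size_cat -!cardE cardsDS // cU cV cW subnKC.
have all_l (U V W : {set 'I_n.+1}) : U \subset A -> W \subset A ->
    all (fun x => x \in [seq nat_of_ord i | i <- enum A])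
      [seq nat_of_ord i | i <- enum W ++ enum (U :\: V)].
  move=> /fintype.subsetP UA /fintype.subsetP WA; apply/allP => _ /mapP[i iU ->].
  apply: map_f; rewrite mem_enum; move: iU; rewrite mem_cat !mem_enum inE.
  by case/orP => [/WA//|/andP[_ /UA]].
have sum_l (U V W : {set 'I_n.+1}) :
    (sumn [seq nat_of_ord i | i <- enum W ++ enum (U :\: V)])%:Z =
    \sum_(i in W) (i : nat)%:Z + \sum_(i in U :\: V) (i : nat)%:Z.
  rewrite sumnE big_map big_cat !big_enum /= PoszD.
  by rewrite !(big_morph Posz PoszD (erefl 0%:Z)).
have /perm_map_inj-/(_ _) :
    perm_eq (map (@nat_of_ord n.+1) l) (map (@nat_of_ord n.+1) l').
  apply: BkA; rewrite ?card_l ?all_l //; try exact: fintype.subset_trans SA.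
    exact: fintype.subset_trans SA'.
  apply/eqP; rewrite -eqz_nat !sum_l; apply/eqP; move: eqd; clear.
  move: (\sum_(i in P) _) (\sum_(i in P') _).
  move: (\sum_(i in S :\: P) _) (\sum_(i in S' :\: P') _).
  lia.
move=> /(_ (@ord_inj n.+1))/permP eql.
have mem_l x : ((x \in P) + (x \in S' :\: P') = (x \in P') + (x \in S :\: P))%N.
  by have := eql (pred1 x); rewrite !count_cat !count_uniq_mem ?enum_uniq // !mem_enum.
have mems x : (x \in P = (x \in P')) /\ (x \in S = (x \in S')).
  have := mem_l x; rewrite !inE.
  have := fintype.subsetP PS x; have := fintype.subsetP PS' x.
  by case: (x \in P); case: (x \in P'); case: (x \in S); case: (x \in S') => //= h1 h2;
    rewrite ?(h1 isT) ?(h2 isT); (try by move: (h1 isT)); (try by move: (h2 isT)).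
congr (_, _); apply/finset.setP => x; by have [] := mems x.
Qed.

(** Twice the signed distance to the midpoint [n / 2], so that it stays an integer. *)
Definition centered (n : nat) (i : 'I_n.+1) : int := 2 * (i : nat)%:Z - n%:Z.

Lemma normr_centered (n : nat) (i : 'I_n.+1) : `|centered i| <= n%:Z.
Proof. by rewrite /centered; have := ltn_ord i; lia. Qed.

(** All pairs have the same excess [p - (k - p)] of plus signs, so recentring shifts every signed
    sum by the same constant. *)
Lemma signed_sum_centered (n k p : nat) (A S P : {set 'I_n.+1}) :
  (S, P) \in signed_pairs k p A ->
  2 * signed_sum (fun i : 'I_n.+1 => (i : nat)%:Z) S P - n%:Z * (2 * p%:Z - k%:Z) =
  signed_sum (@centered n) S P.
Proof.
rewrite inE /= => /and4P[_ /eqP cS PS /eqP cP].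
have cD : #|S :\: P|%:Z = k%:Z - p%:Z.
  by rewrite cardsDS // cS cP -subzn // -cS -cP subset_leq_card.
rewrite /signed_sum /centered !sumrB -!mulr_sumr !sumr_const.
rewrite -![n%:Z *+ _]mulr_natr !natz cP cD; ring.
Qed.

Lemma normr_signed_sum_centered (n : nat) (S P : {set 'I_n.+1}) : P \subset S ->
  `|signed_sum (@centered n) S P| <= (n * #|S|)%:Z.
Proof.
move=> PS; apply: le_trans (ler_normB _ _) _.
apply: le_trans (lerD (ler_norm_sum _ _ _) (ler_norm_sum _ _ _)) _.
have := @big_setID _ _ +%R _ S P (fun i => `|centered i|).
rewrite (finset.setIidPr PS) => <-.
apply: le_trans (ler_sum _ (fun i _ => normr_centered i)) _.
by rewrite sumr_const -mulr_natr natz PoszM.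
Qed.

(** * Bounding the binomial coefficient of a [B_k]-sequence *)

Lemma Bk_card_bound (n k : nat) (A : {set 'I_n.+1}) : (0 < k)%N -> (0 < n)%N ->
  is_Bk k [seq nat_of_ord i | i <- enum A] ->
  (2 ^ k * 'C(#|A|, k) <= 6 * uphalf k * n)%N.
Proof.
move=> k0 n0 BkA; set q := uphalf k; set C := 'C(#|A|, k).
have q0 : (0 < q)%N by rewrite /q; lia.
have qk : (q <= k)%N by rewrite /q; lia.
pose X := signed_pairs k q A; set B := 'C(k, q).
have cX : #|X| = (C * B)%N by rewrite card_signed_pairs.
have B0 : (0 < B)%N by rewrite bin_gt0.
have inj := signed_sum_inj qk BkA.
have ctr := @signed_sum_centered n k q A.
have XnE : (#|X| ^ 2 <= 9 * q * n ^ 2)%N.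
  (* For [k <= 2] the inequality [BDk] below fails; there the range of the signed sums alone gives
     [#|X| <= n * k + 1 <= 3 * n]. *)
  have [k1|k2] := ltnP 2 k; last first.
    have : (#|X| <= (n * k).+1)%N.
      apply: (card_int_span (c := n%:Z * (2 * q%:Z - k%:Z)) inj) => -[S P] SPX.
      rewrite (ctr _ _ SPX); move: SPX; rewrite inE => /and4P[_ /eqP cS PS _].
      by rewrite -cS; exact: normr_signed_sum_centered.
    have -> : q = 1%N by rewrite /q; lia.
    rewrite muln1 => h; apply: (@leq_trans ((3 * n) ^ 2)); last by rewrite expnMn.
    rewrite leq_sqr; nia.
  have q2 : (1 < q)%N by rewrite /q; lia.
  set D := 'C(k.-2, q.-1).
  have BD : (q * B = (4 * q - 2) * D)%N by apply: half_bin_sub2; lia.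
  have BD4 : (B <= 4 * D)%N.
    by rewrite -(leq_pmul2l q0) BD mulnCA mulnA leq_mul2r; apply/orP; right; lia.
  (* By [BD] this follows from [3 * k + 4 <= 8 * q], which holds since [k <= 2 * q] and [2 <= q]. It
     turns the moment bound [12 * C * D * k * n ^ 2] into [#|X| * (8 * q * n ^ 2)]. *)
  have BDk : (12 * k * D <= 8 * q * B)%N.
    rewrite -[(8 * q * B)%N]mulnA BD !mulnA leq_mul2r; apply/orP; right; rewrite /q; lia.
  have mom (S : {set 'I_n.+1}) : #|S| = k ->
      \sum_(P : {set 'I_n.+1} | (P \subset S) && (#|P| == q))
        signed_sum (@centered n) S P ^+ 2 <= (4 * D * k * n ^ 2)%:Z.
    move=> cS; have := @second_moment_signed_sum _ (@centered n) S q.-1.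
    rewrite prednK // cS => /(_ BD4) h; apply: le_trans h _.
    rewrite -[(4 * D * k * n ^ 2)%N]mulnA [leRHS]PoszM ler_wpM2l // -cS.
    apply: (@le_trans _ _ (\sum_(i in S) n%:Z ^+ 2)); last first.
      by rewrite sumr_const -mulr_natl natz PoszM.
    apply: ler_sum => i _; rewrite -real_normK ?num_real //.
    by rewrite lerXn2r ?nnegrE ?normr_centered.
  have := sum_sqr_int_ge (n%:Z * (2 * q%:Z - k%:Z)) inj.
  rewrite (eq_bigr (fun u => signed_sum (@centered n) u.1 u.2 ^+ 2)); last first.
    by move=> [S P] /ctr ->.
  rewrite (@big_signed_pairs _ _ _ _ _
    (fun S P => signed_sum (@centered n) S P ^+ 2)) => h.
  have {h} : #|X|%:Z * (#|X|%:Z ^+ 2 - 1) <= 3 * (C * (4 * D * k * n ^ 2))%:Z.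
    apply: le_trans h _; rewrite ler_pM2l //.
    apply: (@le_trans _ _ (\sum_(S : {set 'I_n.+1} | (S \subset A) && (#|S| == k))
       (4 * D * k * n ^ 2)%:Z)).
      by apply: ler_sum => S /andP[_ /eqP]; exact: mom.
    rewrite [leRHS]PoszM /C -cards_draws -[X in _ <= X * _]natz mulr_natl -sumr_const.
    rewrite le_eqVlt; apply/predU1P; left.
    by apply: eq_bigl => S; rewrite inE.
  have [->|X0] := posnP #|X|; first by [].
  move=> h; have {h} : #|X|%:Z * (#|X|%:Z ^+ 2 - 1) <= #|X|%:Z * (8 * q * n ^ 2)%:Z.
    apply: le_trans h _; rewrite cX -!PoszM lez_nat.
    have := leq_mul (leqnn (C * n ^ 2)) BDk; clear; lia.
  rewrite ler_pM2l // => h.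
  have : (#|X| ^ 2 <= 8 * q * n ^ 2 + 1)%N by lia.
  (* Raising the constant from 8 to 9 absorbs the [+ 1]. *)
  have : (1 <= q * n ^ 2)%N by rewrite muln_gt0 q0 expn_gt0 n0.
  clear; lia.
have pow : ((2 ^ k) ^ 2 <= 4 * q * B ^ 2)%N := half_bin_ge k0.
(* Squaring avoids the root in the binomial estimate; [4 * q] times [9 * q * n ^ 2] is the perfect
   square [(6 * q * n) ^ 2]. *)
rewrite -leq_sqr expnMn.
apply: (@leq_trans (4 * q * B ^ 2 * C ^ 2)); first by rewrite leq_mul2r pow orbT.
have -> : (4 * q * B ^ 2 * C ^ 2 = 4 * q * #|X| ^ 2)%N by rewrite cX; ring.
have -> : ((6 * q * n) ^ 2 = 4 * q * (9 * q * n ^ 2))%N by ring.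
by rewrite leq_mul2l XnE orbT.
Qed.

(** Both multisets are padded with [k - j] copies of a fixed element of [A]. *)
Lemma Bk_le (k j : nat) (A : seq nat) : (j <= k)%N -> A != [::] ->
  is_Bk k A -> is_Bk j A.
Proof.
case: A => // a A jk _ BkA s t ss st As At eqst.
have pad (u : seq nat) : size u = j -> size (u ++ nseq (k - j) a) = k.
  by move=> su; rewrite size_cat size_nseq su subnKC.
rewrite -(perm_cat2r (nseq (k - j) a)); apply: BkA; rewrite ?pad //.
- by rewrite all_cat As all_nseq mem_head orbT.
- by rewrite all_cat At all_nseq mem_head orbT.
- by rewrite !sumn_cat eqst.
Qed.

(** * Numerical bounds for [pi] and [e] *)

Lemma sin_le_id (R : realType) (x : R) : 0 <= x -> sin x <= x.
Proof.
move=> x0; have [|c _] := @MVT_segment R sin cos 0 x x0 (fun y _ => is_derive_sin y).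
  by apply: continuous_subspaceT => y; exact: continuous_sin.
rewrite sin0 !subr0 => ->; rewrite -[leRHS]mul1r ler_wpM2r //; exact: cos_le1.
Qed.

(* [s = sin (pi / 6)] solves [3 s - 4 s^3 = sin (pi / 2) = 1], so [s = 1 / 2]. *)
Lemma pi_ge3 (R : realType) : 3 <= pi :> R.
Proof.
have p0 := pi_gt0 R; pose x : R := pi / 6.
have s0 : 0 < sin x by apply: sin_gt0_pi; rewrite /x; apply/andP; split; lra.
have : sin (x + x + x) = 1.
  by rewrite -(sin_pihalf R); congr sin; rewrite /x; lra.
rewrite sinD sinD cosD.
have := cos2sin2 x; have := @sin_le_id _ x; rewrite /x.
move: (sin _) (cos _) s0 => s c s0 sx c2 h.
have /eqP : (s + 1) * (2 * s - 1) ^+ 2 = 0.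
  transitivity (1 - ((s * c + c * s) * c + (c * c - s * s) * s) +
    3 * s * (c ^+ 2 - (1 - s ^+ 2))); first by ring.
  by rewrite h c2; ring.
(* The root [s = -1] contradicts positivity; for [s = 1 / 2], [sin x <= x] reads
   [1 / 2 <= pi / 6]. *)
rewrite mulf_eq0 sqrf_eq0 => /orP[] /eqP; lra.
Qed.

(** The first four terms of the series: [1 + 1 + 1/2 + 1/6]. *)
Lemma expR1_ge (R : realType) : 8 / 3 <= expR 1 :> R.
Proof.
have := nondecreasing_cvgn_le _ (is_cvg_series_exp_coeff (1 : R)) 4.
rewrite /series /= !big_nat_recr //= big_geq // /exp_coeff /=.
rewrite !expr1n (_ : 0`! = 1)%N // (_ : 1`! = 1)%N //.
rewrite (_ : 2`! = 2)%N // (_ : 3`! = 6)%N //.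
rewrite /expR => h; apply: le_trans (h _); last first.
  apply/nondecreasing_seqP => i; rewrite big_nat_recr //= lerDl.
  by rewrite divr_ge0 // exprn_ge0.
lra.
Qed.

(** * Lower bounds for falling factorials and powers *)

Lemma expR_chord (R : realType) (r : R) : 0 <= r <= 1 ->
  expR (1 - r) <= expR 1 - (expR 1 - 1) * r.
Proof.
move=> r01; have := @convex_expR R (Itv01 (andP r01).1 (andP r01).2) 0 1.
rewrite !convRE /= expR0 /unstable.onem => h.
apply: le_trans (le_trans h _); last by lra.
by rewrite le_eqVlt; apply/predU1P; left; congr expR; lra.
Qed.

(** For [d = m - k] this is the falling factorial bound in terms of [m - (1 - 1/e) k]; for [d = 0]
    it is [(k / e)^k <= k!]. The induction on [k] keeps [d] fixed. *)
Lemma expR_shifted_fact (R : realType) (d k : nat) :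
  (k%:R / expR 1 + d%:R) ^+ k * d`!%:R <= ((k + d)`!%:R : R).
Proof.
have e0 : 0 < expR 1 :> R by exact: expR_gt0.
have e1 := expR1_ge R; set e : R := expR 1 in e0 e1 *.
elim: k => [|k IH]; first by rewrite expr0 mul1r.
pose u : R := k%:R / e + d%:R.
(* Division by [u] requires [0 < k], since [u] vanishes for [k = d = 0]. *)
have [k0|k0] := posnP k.
  rewrite k0 add1n factS natrM expr1 ler_wpM2r // mul1r -natr1 addrC lerD2l.
  by rewrite invf_le1 //; lra.
have u0 : 0 < u by rewrite /u ltr_pwDl // divr_gt0 // ltr0n.
have uN : u != 0 by rewrite gt_eqF.
(* The base grows from [u] to [u (1 + 1/(e u))], and [(1 + 1/(e u))^k <= exp(k/(e u)) = exp(1 -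
   d/u)], which the chord bounds linearly in [r = d/u]. *)
have step : (k.+1%:R / e + d%:R) ^+ k.+1 <= (k.+1 + d)%:R * u ^+ k.
  have eu : e * u = k%:R + e * d%:R by rewrite /u; field; rewrite gt_eqF.
  have -> : k.+1%:R / e + d%:R = u * (1 + (e * u)^-1).
    rewrite -natr1 mulrDr mulr1 (invfM e) mulrCA mulfV // mulr1 /u; ring.
  pose r : R := d%:R / u.
  have r01 : 0 <= r <= 1.
    rewrite /r divr_ge0 ?(ltW u0) //= ler_pdivrMr // mul1r lerDr.
    by rewrite divr_ge0 ?(ltW e0).
  have ru : r * u = d%:R by rewrite /r divfK.
  have pow : (1 + (e * u)^-1) ^+ k <= e - (e - 1) * r.
    apply: le_trans (expR_chord r01).
    have -> : 1 - r = (e * u)^-1 * k%:R.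
      apply: (mulIf (x := e * u)); first by rewrite mulf_neq0 ?gt_eqF.
      rewrite mulrAC mulVf ?mul1r ?mulf_neq0 ?gt_eqF //.
      rewrite mulrBl mul1r mulrCA ru eu; ring.
    rewrite expRM_natr lerXn2r ?nnegrE ?expR_ge0 ?expR_ge1Dx //.
    by rewrite addr_ge0 // invr_ge0 mulr_ge0 ?ltW.
  have uW : u * (1 + (e * u)^-1) = u + e^-1.
    by rewrite mulrDr mulr1 (invfM e) mulrCA mulfV // mulr1.
  rewrite exprS exprMn uW mulrCA mulrC ler_wpM2r ?exprn_ge0 ?(ltW u0) //.
  have ei0 : 0 < e^-1 by rewrite invr_gt0.
  apply: le_trans (ler_wpM2l _ pow) _; first by rewrite addr_ge0 ?ltW.
  (* Since [r * u = d], the product equals [k + 1 + d - (1 - 1/e) r]. *)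
  have -> : (u + e^-1) * (e - (e - 1) * r) =
      e * u + e^-1 * e - (e - 1) * (r * u) - (1 - e^-1) * r.
    by field; rewrite gt_eqF.
  rewrite eu ru mulVf ?gt_eqF // natrD -natr1.
  have : 0 <= (1 - e^-1) * r.
    by rewrite mulr_ge0 ?(andP r01).1 // subr_ge0 invf_le1 //; lra.
  lra.
rewrite addSn factS natrM; apply: le_trans (ler_wpM2l _ IH) => //.
by rewrite mulrA ler_wpM2r // -addSn.
Qed.

Lemma bernoulli_exprn (R : realFieldType) (w : R) (k : nat) :
  0 <= w -> 1 + k%:R * w <= (1 + w) ^+ k.
Proof.
move=> w0; elim: k => [|k IH]; first by rewrite mul0r addr0 expr0.
rewrite exprS; apply: le_trans (ler_wpM2l _ IH); last by rewrite addr_ge0.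
have : 0 <= k%:R * w ^+ 2 by rewrite mulr_ge0 ?exprn_ge0.
rewrite -natr1; lra.
Qed.

(** Each unit added to the base at least doubles the power: by Bernoulli,
    [(1 + 1/t)^k >= 1 + k/t >= 2] while [t <= k]. *)
Lemma expn2_mul_exprn_le (R : realFieldType) (k d : nat) (t : R) :
  0 < t -> t + d%:R <= k%:R -> 2 ^+ d * t ^+ k <= (t + d%:R) ^+ k.
Proof.
elim: d t => [|d IH] t t0 tk; first by rewrite expr0 mul1r addr0.
have step : 2 * t ^+ k <= (t + 1) ^+ k.
  have tk' : 1 <= k%:R * t^-1.
    by rewrite ler_pdivlMr // mul1r; apply: le_trans tk; rewrite lerDl.
  have -> : t + 1 = t * (1 + t^-1) by rewrite mulrDr mulr1 divff ?gt_eqF.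
  rewrite exprMn mulrC ler_pM2l ?exprn_gt0 //.
  apply: le_trans (bernoulli_exprn k _); last by rewrite invr_ge0 ltW.
  lra.
rewrite exprSr -mulrA; apply: le_trans (ler_wpM2l _ step) _; first exact: exprn_ge0.
rewrite -[d.+1%:R]nat1r addrA; apply: IH; first by rewrite addr_gt0.
by rewrite -addrA nat1r.
Qed.

(** * From binomial coefficients to [k]-th powers and roots *)

Lemma Bk_card_exprn_le (R : realType) (k n : nat) (A : {set 'I_n.+1}) :
  (0 < k)%N -> (0 < n)%N -> is_Bk k [seq nat_of_ord i | i <- enum A] ->
  let t : R := #|A|%:R - (expR 1 - 1) / expR 1 * k%:R in
  0 < t -> t ^+ k <= 6 * (uphalf k)%:R * k`!%:R / 2 ^+ k * n%:R.
Proof.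
move=> k0 n0 BkA t t0; set m := #|A|; set e : R := expR 1.
have e1 : 8 / 3 <= e by exact: expR1_ge.
have e0 : 0 < e by exact: expR_gt0.
have tE : t = k%:R / e + (m%:R - k%:R) by rewrite /t -/e; field; rewrite gt_eqF.
suff : 2 ^+ k * t ^+ k <= k`!%:R * (6 * uphalf k * n)%N%:R.
  move=> h; rewrite -(@ler_pM2l _ (2 ^+ k)) ?exprn_gt0 //; apply: le_trans h _.
  rewrite !natrM le_eqVlt; apply/predU1P; left; field.
  by rewrite expf_neq0 // pnatr_eq0.
have fact_pos i : 0 < i`!%:R :> R by rewrite ltr0n fact_gt0.
have [km|mk] := leqP k m.
  have bnd := Bk_card_bound k0 n0 BkA.
  apply: (@le_trans _ _ (k`!%:R * (2 ^ k * 'C(m, k))%N%:R)); last first.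
    by rewrite ler_pM2l // ler_nat.
  rewrite natrM natrX mulrCA ler_pM2l ?exprn_gt0 //.
  have := expR_shifted_fact R (m - k) k; rewrite subnKC // natrB // -/e -tE.
  by rewrite -(bin_fact km) mulnA natrM ler_pM2r // mulnC natrM.
have m0 : (0 < m)%N.
  rewrite lt0n; apply/negP => /eqP mE; move: t0; rewrite /t -/m mE -/e add0r.
  by rewrite oppr_gt0 ltNge mulr_ge0 // divr_ge0 ?(ltW e0) // subr_ge0; lra.
have BmA : is_Bk m [seq nat_of_ord i | i <- enum A].
  apply: (Bk_le (ltnW mk) _ BkA); move: m0; rewrite /m cardE.
  by case: (enum A).
have := Bk_card_bound m0 n0 BmA; rewrite -/m binn muln1 => bnd.
(* As [t + (k - m) = k / e], doubling [k - m] times gives [2^(k-m) t^k <= (k/e)^k <= k!]; the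
   missing factor [2^m] is bounded by [bnd]. *)
have te : t + (k - m)%:R = k%:R / e by rewrite tE natrB ?(ltnW mk) //; ring.
have := @expn2_mul_exprn_le R k (k - m) t t0; rewrite te.
have -> : k%:R / e <= k%:R by rewrite ler_pdivrMr // ler_peMr //; lra.
move=> /(_ isT) h.
have kf := expR_shifted_fact R 0 k; rewrite fact0 mulr1 addr0 addn0 in kf.
have := le_trans h kf => {}h.
have -> : 2 ^+ k = 2 ^+ m * 2 ^+ (k - m) :> R by rewrite -exprD subnKC // ltnW.
rewrite -mulrA; apply: (@le_trans _ _ ((2 ^ m)%N%:R * k`!%:R)).
  by rewrite natrX ler_pM2l ?exprn_gt0.
rewrite mulrC ler_pM2l // ler_nat; apply: leq_trans bnd _.
by rewrite leq_mul2r leq_mul2l uphalf_leq ?orbT // ltnW.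
Qed.

Unset Implicit Arguments.

Theorem theorem5 (R : realType) (k n : nat) (hk : (0 < k)%N) (hn : (0 < n)%N) :
  (Phi k n)%:R <=
    ((expR (1 : R) * pi ^+ 2 * ((k.+1)./2)%:R * (k`!)%:R / 2 ^+ (k + 2))
       `^ (k%:R)^-1) * (n%:R `^ (k%:R)^-1)
    + (expR 1 - 1) / expR 1 * k%:R.
Proof.
set coef := _ / 2 ^+ (k + 2).
have e1 := expR1_ge R; have p3 := pi_ge3 R.
have coef0 : 0 <= coef.
  by rewrite /coef !(mulr_ge0, invr_ge0, exprn_ge0, expR_ge0, pi_ge0).
rewrite -powRM //; rewrite /Phi.
elim/big_ind: _ => [|x y hx hy|A /asboolP BkA].
- rewrite addr_ge0 ?powR_ge0 // mulr_ge0 // divr_ge0 ?expR_ge0 // subr_ge0; lra.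
- by rewrite /maxn; case: ifP.
rewrite -lerBlDr; set t := _ - _.
have [t0|t0] := leP t 0; first exact: le_trans t0 (powR_ge0 _ _).
have -> : t = (t ^+ k) `^ k%:R^-1.
  by rewrite -powR_mulrn ?ltW // -powRrM divff ?powRr1 ?pnatr_eq0 -?lt0n // ltW.
apply: ge0_ler_powR; rewrite ?nnegrE ?invr_ge0 //.
- by rewrite exprn_ge0 // ltW.
- by rewrite (mulr_ge0 coef0).
apply: le_trans (Bk_card_exprn_le hk hn BkA t0) _.
rewrite ler_wpM2r // /coef -[(k.+1)./2]/(uphalf k) exprD.
have -> : expR 1 * pi ^+ 2 * (uphalf k)%:R * k`!%:R / (2 ^+ k * 2 ^+ 2) =
    (expR 1 * pi ^+ 2 / 4) * ((uphalf k)%:R * k`!%:R / 2 ^+ k) :> R.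
  by field; rewrite expf_neq0 // pnatr_eq0.
have -> (x y z : R) : 6 * x * y / z = 6 * (x * y / z) by ring.
rewrite ler_wpM2r ?mulr_ge0 ?invr_ge0 ?exprn_ge0 //.
rewrite ler_pdivlMr //.
(* The bounds [8 / 3 <= e] and [3 <= pi] are just enough: [8/3 * 9/4 = 6]. *)
nra.
Qed.
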